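(* Let $f$ and $g$ be the functions defined in the context. Then for every positive integer $n$ and every positive integer $m$, $g(n,m)\leq m-1$; moreover $$0=g(n,1)<1=g(n,2)\leq g(n,3)\leq g(n,4)\leq \ldots$$ and $$g(n,f(n))<f(n)=g(n,f(n)+1)=g(n,f(n)+2)=g(n,f(n)+3)=\ldots$$
   Context: For a positive integer $n$, let $E_n=\{x_k=1,\ x_i+x_j=x_k,\ x_i\cdot x_j=x_k:\ i,j,k\in\{1,\ldots,n\}\}$. Let $f(n)$ denote the smallest non-negative integer $b$ such that for each system $S\subseteq E_n$ which has a solution in non-negative integers $x_1,\ldots,x_n$, there exists a solution of $S$ in non-negative integers not greater than $b$. For tuples $x=(x_1,\ldots,x_n),\ y=(y_1,\ldots,y_n)\in\mathbb{N}^n$, say that $y$ is a duplicate of $x$ if: for all $k$, $x_k=1\Rightarrow y_k=1$; for all $i,j,k$, $x_i+x_j=x_k\Rightarrow y_i+y_j=y_k$; and for all $i,j,k$, $x_i\cdot x_j=x_k\Rightarrow y_i\cdot y_j=y_k$ (indices ranging over $\{1,\ldots,n\}$). For positive integers $n,m$, let $X_m=\{0,1,\ldots,m-1\}$ and call $x\in X_m^n$ removable if there is a duplicate $y\in X_m^n$ of $x$ with $\max(y_1,\ldots,y_n)<\max(x_1,\ldots,x_n)$. Define $g(n,m)$ as the maximum of $\max(x_1,\ldots,x_n)$ over all non-removable $x\in X_m^n$. (This is the number printed on the $m$-th iteration of the paper's infinite MuPAD loop on input $n$: on the $m$-th iteration the loop takes all $n$-tuples from $\{0,\ldots,m-1\}$,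 discards each tuple having a duplicate in the same set with strictly smaller maximum entry, and prints the largest entry among the remaining tuples.) *)

(* Defs.v *)
From HB Require Import structures.
From mathcomp Require Import all_boot.
From mathcomp Require Import boolp.

Set Implicit Arguments.
Unset Strict Implicit.
Unset Printing Implicit Defensive.

(* The elements of E_n: [EqOne k] is x_k = 1, [EqAdd i j k] is x_i + x_j = x_k
   and [EqMul i j k] is x_i * x_j = x_k. *)
Inductive equation (n : nat) :=
  | EqOne of 'I_n
  | EqAdd of 'I_n & 'I_n & 'I_n
  | EqMul of 'I_n & 'I_n & 'I_n.

Definition equation_code n (e : equation n) :
    'I_n + 'I_n * 'I_n * 'I_n + 'I_n * 'I_n * 'I_n :=
  match e with
  | EqOne k => inl (inl k)
  | EqAdd i j k => inl (inr (i, j, k))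
  | EqMul i j k => inr (i, j, k)
  end.

Definition equation_decode n
    (c : 'I_n + 'I_n * 'I_n * 'I_n + 'I_n * 'I_n * 'I_n) : equation n :=
  match c with
  | inl (inl k) => EqOne k
  | inl (inr (i, j, k)) => EqAdd i j k
  | inr (i, j, k) => EqMul i j k
  end.

Lemma equation_codeK n : cancel (@equation_code n) (@equation_decode n).
Proof. by case. Qed.

HB.instance Definition _ n :=
  Finite.copy (equation n) (can_type (@equation_codeK n)).

Definition satisfies n (x : 'I_n -> nat) (e : equation n) : Prop :=
  match e with
  | EqOne k => x k = 1
  | EqAdd i j k => x i + x j = x k
  | EqMul i j k => x i * x j = x k
  end.

Definition solution n (S : {set equation n}) (x : 'I_n -> nat) : Prop :=
  forall e, e \in S -> satisfies x e.

Definition solution_bound (n b : nat) : Prop :=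
  forall S : {set equation n},
    (exists x, solution S x) ->
    exists2 x, solution S x & forall i, x i <= b.

Lemma solution_bound_exists n : exists b, `[< solution_bound n b >].
Proof.
have bndS (S : {set equation n}) : exists b, (exists x, solution S x) ->
    exists2 x, solution S x & forall i, x i <= b.
  have [[x Sx]|noS] := pselect (exists x, solution S x); last by exists 0.
  by exists (\max_i x i) => _; exists x => // i; apply: leq_bigmax.
have [b Pb] := choice bndS.
exists (\max_S b S); apply/asboolP => S /Pb[x Sx xb].
by exists x => // i; apply: leq_trans (xb i) (leq_bigmax S).
Qed.

Definition f (n : nat) : nat := ex_minn (solution_bound_exists n).

Definition duplicate n (x y : 'I_n -> nat) : bool :=
  [&& [forall k, (x k == 1) ==> (y k == 1)],
      [forall i, forall j, forall k,
         (x i + x j == x k) ==> (y i + y j == y k)] &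
      [forall i, forall j, forall k,
         (x i * x j == x k) ==> (y i * y j == y k)]].

Definition max_entry n (x : 'I_n -> nat) : nat := \max_i x i.

(* X_m^n is {ffun 'I_n -> 'I_m}; [val \o x] is x seen in N^n. *)
Definition removable n m (x : {ffun 'I_n -> 'I_m}) : bool :=
  [exists y : {ffun 'I_n -> 'I_m},
     duplicate (val \o x) (val \o y) &&
     (max_entry (val \o y) < max_entry (val \o x))].

(* \max is 0 on an empty range; by [nonremovable_exists] the range is
   nonempty whenever 0 < m. *)
Definition g (n m : nat) : nat :=
  \max_(x : {ffun 'I_n -> 'I_m} | ~~ removable x) max_entry (val \o x).

Lemma nonremovable_exists n m :
  0 < m -> exists x : {ffun 'I_n -> 'I_m}, ~~ removable x.
Proof.
move=> m_gt0; exists [ffun=> Ordinal m_gt0].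
apply/existsP => -[y /andP[_]].
by rewrite [X in _ < X]big1 // => i _; rewrite /= ffunE.
Qed.

(* Main.v *)
Require Import Defs.
From mathcomp Require Import all_boot.
From mathcomp Require Import boolp.

(** A duplicate of [x] with a smaller maximum stays inside every box that
    contains [x], so being non-removable does not depend on the box: it says that
    [x] has the least maximum among the solutions of the system of all equations
    that [x] satisfies. Hence [g n] is nondecreasing. No such [x] has an entry
    above [f n], and by minimality of [f n] some such [x] has maximum exactly
    [f n]. *)

Definition minimal_tuple {n} (x : 'I_n -> nat) : Prop :=
  forall y, duplicate x y -> max_entry x <= max_entry y.

Lemma leq_max_entry n (x : 'I_n -> nat) i : x i <= max_entry x.
Proof. exact: leq_bigmax. Qed.

Lemma max_entry_leqP n (x : 'I_n -> nat) b :
  reflect (forall i, x i <= b) (max_entry x <= b).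
Proof.
by rewrite /max_entry; apply: (iffP (bigmax_leqP _ _ _)) => xb i *; apply: xb.
Qed.

(** Positivity of [m] covers [n = 0], where the empty maximum is 0. *)
Lemma max_entry_ltn n (x : 'I_n -> nat) m :
  0 < m -> (forall i, x i < m) -> max_entry x < m.
Proof. by case: m => // m _ xm; rewrite ltnS; apply/max_entry_leqP. Qed.

Lemma duplicateP n (x y : 'I_n -> nat) :
  reflect (forall e, satisfies x e -> satisfies y e) (duplicate x y).
Proof.
apply: (iffP and3P) => [[/forallP d1 /forallP dA /forallP dM]|d].
  case=> [k|i j k|i j k] /= /eqP.
  - by move=> xk; apply/eqP/(implyP (d1 k)).
  - by move=> xk; apply/eqP/(implyP (forallP (forallP (dA i) j) k)).
  - by move=> xk; apply/eqP/(implyP (forallP (forallP (dM i) j) k)).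
split.
- by apply/forallP => k; apply/implyP => /eqP xk; apply/eqP/(d (EqOne k)).
- apply/forallP => i; apply/forallP => j; apply/forallP => k.
  by apply/implyP => /eqP xk; apply/eqP/(d (EqAdd i j k)).
- apply/forallP => i; apply/forallP => j; apply/forallP => k.
  by apply/implyP => /eqP xk; apply/eqP/(d (EqMul i j k)).
Qed.

Lemma duplicate_solution n (S : {set equation n}) x y :
  solution S x -> duplicate x y -> solution S y.
Proof. by move=> Sx /duplicateP d e /Sx /d. Qed.

Lemma tuple_in_box n m (x : 'I_n -> nat) : (forall i, x i < m) ->
  exists X : {ffun 'I_n -> 'I_m}, val \o X = x.
Proof.
move=> xm; exists [ffun i => Ordinal (xm i)].
by apply/funext => i /=; rewrite ffunE.
Qed.

Lemma nonremovableP n m (x : {ffun 'I_n -> 'I_m}) :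
  reflect (minimal_tuple (val \o x)) (~~ removable x).
Proof.
apply: (iffP idP) => [nr y dxy|xmin]; last first.
  by apply/existsP => -[y /andP[/xmin]]; rewrite leqNgt => /negP.
rewrite leqNgt; apply: contra nr => yx.
have ym i : y i < m.
  have x_m : max_entry (val \o x) < m.
    apply: max_entry_ltn => [|j]; last exact: ltn_ord.
    (* The entry [x i] inhabits ['I_m], so [m] is positive. *)
    exact: leq_ltn_trans (leq0n _) (ltn_ord (x i)).
  exact: leq_ltn_trans (leq_max_entry _ y i) (ltn_trans yx x_m).
have [Y defY] := tuple_in_box _ _ _ ym.
by apply/existsP; exists Y; rewrite defY dxy.
Qed.

(** Together with [g_leq], this reduces every estimate of [g] to minimal tuples in N^n, away from
    finite functions and removability. *)
Lemma leq_g n m (x : 'I_n -> nat) :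
  (forall i, x i < m) -> minimal_tuple x -> max_entry x <= g n m.
Proof.
move=> /tuple_in_box[X <-] /nonremovableP nrX.
by rewrite /g; apply: (bigmax_sup X).
Qed.

Lemma g_leq n m b :
  (forall x : 'I_n -> nat, (forall i, x i < m) -> minimal_tuple x ->
     max_entry x <= b) ->
  g n m <= b.
Proof.
move=> gb; apply/bigmax_leqP => X /nonremovableP Xmin.
by apply: gb => // i /=.
Qed.

Lemma g_leq_pred n m : g n m <= m.-1.
Proof.
apply: g_leq => x xm _; apply/max_entry_leqP => i.
by have := xm i; case: m {xm}.
Qed.

Lemma g_mono n m p : m <= p -> g n m <= g n p.
Proof.
move=> mp; apply: g_leq => x xm; apply: leq_g => i.
exact: leq_trans (xm i) mp.
Qed.

Lemma g2 n : 0 < n -> g n 2 = 1.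
Proof.
move=> n_gt0; apply/eqP; rewrite eqn_leq g_leq_pred /=.
pose i0 := Ordinal n_gt0.
(* The constant tuple 1 is minimal: the equations x_k = 1 force each of its duplicates to equal
   it. *)
apply: leq_trans (leq_max_entry _ (fun=> 1) i0) _.
apply: leq_g => // y /duplicateP d; apply/max_entry_leqP => i.
by rewrite -[X in X <= _](d (EqOne i) erefl) leq_max_entry.
Qed.

Lemma solution_bound_f n : solution_bound n (f n).
Proof. by rewrite /f; case: ex_minnP => b /asboolP. Qed.

Lemma f_leq n b : solution_bound n b -> f n <= b.
Proof. by rewrite /f => nb; case: ex_minnP => c _; apply; apply/asboolP. Qed.

(** The system {x_k = 1} is solvable, but not by zeros. *)
Lemma f_gt0 n : 0 < n -> 0 < f n.
Proof.
move=> n_gt0; pose i0 := Ordinal n_gt0.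
have [|x Sx /(_ i0)] := solution_bound_f n [set EqOne i0].
  by exists (fun=> 1) => e; rewrite inE => /eqP->.
by rewrite (Sx (EqOne i0)) ?inE.
Qed.

(** The system of all equations true of [x] is solvable, hence has a solution bounded by [f n]; that
    solution is a duplicate of [x]. *)
Lemma minimal_tuple_leq_f n (x : 'I_n -> nat) :
  minimal_tuple x -> max_entry x <= f n.
Proof.
move=> xmin.
have [|y Sy /max_entry_leqP yf] :=
    solution_bound_f n [set e | `[< satisfies x e >]].
  by exists x => e; rewrite inE => /asboolP.
apply: leq_trans (xmin y _) yf; apply/duplicateP => e xe.
by apply: Sy; rewrite inE; apply/asboolP.
Qed.

Lemma minimal_tuple_f n : 0 < f n ->
  exists2 x : 'I_n -> nat, minimal_tuple x & max_entry x = f n.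
Proof.
move=> f_gt0.
(* Some solvable [S] has no solution below [f n]. Its solution bounded by [f n] then has maximum
   exactly [f n], and is minimal because its duplicates also solve [S]. *)
have /existsNP[S /not_implyP[exS noS]] : ~ solution_bound n (f n).-1.
  by move/f_leq; rewrite -ltnS prednK // ltnn.
have big y : solution S y -> f n <= max_entry y.
  move=> Sy; rewrite leqNgt; apply/negP => yf; apply: noS; exists y => //.
  by apply/max_entry_leqP; rewrite -ltnS prednK.
have [x Sx /max_entry_leqP xf] := solution_bound_f n S exS.
have xE : max_entry x = f n by apply/eqP; rewrite eqn_leq xf big.
by exists x => // y /(duplicate_solution _ _ _ _ Sx)/big; rewrite xE.
Qed.

Lemma g_stable n m : 0 < f n -> f n < m -> g n m = f n.
Proof.
move=> f_gt0 fm; apply/eqP; rewrite eqn_leq; apply/andP; split.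
  by apply: g_leq => x _; apply: minimal_tuple_leq_f.
have [x xmin xE] := minimal_tuple_f n f_gt0.
(* The box has entries below [m], so [f n < m] is exactly what lets [x] fit in it. *)
rewrite -{1}xE; apply: leq_g => // i.
by apply: leq_ltn_trans fm; rewrite -xE leq_max_entry.
Qed.

Theorem theorem2 (n : nat) (hn : 0 < n) :
  (forall m : nat, 0 < m -> g n m <= m - 1) /\
  [/\ g n 1 = 0, g n 2 = 1 & forall m : nat, 2 <= m -> g n m <= g n m.+1] /\
  (g n (f n) < f n /\ forall k : nat, 0 < k -> g n (f n + k) = f n).
Proof.
have fn_gt0 := f_gt0 n hn.
split=> [m _|]; first by rewrite subn1 g_leq_pred.
split; first split=> [||m _].
- by apply/eqP; rewrite -leqn0 (g_leq_pred n 1).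
- exact: g2.
- exact: g_mono.
(* Strictness at [f n] is the general bound by the predecessor, as [f n] is positive. *)
split=> [|k k_gt0]; first by rewrite -[ltnRHS](prednK fn_gt0) ltnS g_leq_pred.
by apply: g_stable; rewrite // -[ltnLHS]addn0 ltn_add2l.
Qed.
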